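(* Let $n\ge 3$ and let $A_0$ and $A_1$ be compact subsets of $\mathbf{R}^2$ contained in $G$, a convex $n$-gon with vertices $G_1,\dots,G_n$. Let $s$ be the number of common supporting lines of $A_0$ and $A_1$. Suppose that \[ s < \begin{cases} n, & \text{if } n \text{ is even},\\ n+1, & \text{if } n \text{ is odd}.\end{cases}\] Then there exist $i\in\{0,1\}$ and $j\in\{1,\dots,n\}$ such that \[ A_i \subset \mathrm{Conv}\Bigl(A_{1-i}\cup \bigcup_{k\neq j}\{G_k\}\Bigr).\]
   Context: $\mathrm{Conv}$ denotes the convex hull, and $\subset$ means not necessarily strict inclusion. A convex $n$-gon is the full (filled) convex polygon, i.e. the convex hull of its $n$ vertices. A line $l$ supports a compact set $A\subset\mathbf{R}^2$ if $l\cap A$ is nonempty and $A$ lies in one of the closed half-planes bounded by $l$. A line $l$ is a common supporting line of $A_0$ and $A_1$ if it supports both $A_0$ and $A_1$ and both sets lie in the same closed half-plane bounded by $l$. *)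

(* Defs.v *)
From HB Require Import structures.
From mathcomp Require Export all_boot all_order all_algebra.
From mathcomp Require Export all_classical all_reals all_analysis.

Set Implicit Arguments.
Unset Strict Implicit.
Unset Printing Implicit Defensive.

Export Order.TTheory GRing.Theory Num.Theory.
Export numFieldNormedType.Exports.

Local Open Scope classical_set_scope.
Local Open Scope ring_scope.

Section Plane.
Context {R : realType}.
Local Notation plane := 'rV[R]_2.
Implicit Types (a : plane) (c : R) (l H A B P : set plane).

Definition convex_hull A : set plane := smallest (@convex_set R plane) A.

(* The n points V k are exactly the vertices of P: they span P and none of them
   can be dropped. In particular V is injective, and for n >= 3 the polygon is
   not contained in a line. No cyclic order on the indices is assumed. *)
Definition convex_ngon n P (V : 'I_n -> plane) : Prop :=
  P = convex_hull (range V) /\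
  forall k, ~ convex_hull (V @` [set k' | k' != k]) (V k).

Definition dot a (x : plane) : R := \sum_(i < 2) a 0 i * x 0 i.

Definition is_line l : Prop :=
  exists a c, a != 0 /\ l = [set x | dot a x = c].

(* The other closed half-plane bounded by l is obtained from (- a, - c). *)
Definition closed_halfplane_bounded_by l H : Prop :=
  exists a c, [/\ a != 0, l = [set x | dot a x = c]
                & H = [set x | dot a x <= c]].

Definition supports l A : Prop :=
  [/\ is_line l, l `&` A !=set0
    & exists2 H, closed_halfplane_bounded_by l H & A `<=` H].

Definition common_supporting_line A B l : Prop :=
  [/\ supports l A, supports l B
    & exists H, [/\ closed_halfplane_bounded_by l H, A `<=` H & B `<=` H]].

End Plane.

(* Main.v *)
Require Import Defs.
From mathcomp Require Import ring lra.

Set Implicit Arguments.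
Unset Strict Implicit.
Unset Printing Implicit Defensive.

Local Open Scope classical_set_scope.
Local Open Scope ring_scope.

(** Suppose that the conclusion fails for all [i] and [j]. Write [h i] for the
support function of [A i], and [f] for the difference of [h false] and [h true],
a continuous positively homogeneous function on the plane. If [f] vanishes at a
nonzero [u], then the line of equation [dot u x = h false u] supports both sets,
and both lie on the same side of it. So it is enough to find many zeros of [f]
on the circle of directions, and to check that they give different lines.

Let the normal cone of the vertex [G j] be the open cone of the directions in
which [G j] is the unique highest vertex. These cones are convex and pairwise
disjoint, so they cut disjoint open arcs in the circle. For all [i] and [j],
some point [p] of [A i] is outside the convex hull of [A (~~ i)] and of the
vertices other than [G j]; a line separates [p] strictly from that hull
([strict_separation]), and its normal [u] satisfies [h (~~ i) u < h i u].
Moreover [u] is in the normal cone of [G j]: as [p] is in the polygon, some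
vertex is at least as high as [p], and this can only be [G j]. Hence [f] takes
both signs on each of the [n] arcs, and has a zero on each.

For odd [n] there is one more zero, by parity. Cut the circle at a direction [e]
outside all the cones ([tie_direction]); what is left is a line, on which the
arcs are disjoint intervals. If [f e = 0], then [e] is the extra zero. Otherwise
[f] has the sign of [f e] near both ends of the line, whereas with a single zero
on each arc and no other its sign would change [n] times, an odd number. The
counting is done in [zeros_of_sign_changes], and [zero_directions] applies
it after parametrizing the cut circle by a stereographic projection.

Two zeros on different rays give the same line only if they are opposite, and
then both sets lie in that line. In this case the sign of [f] is constant on
each side of the axis spanned by the two directions, whereas one of the [n >= 3]
arcs avoids the axis, and so lies on one side of it while [f] takes both signs
there ([no_antipodal_zeros]). *)

(** * Vectors of the plane *)

Section PlaneVectors.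
Context {R : realType}.
Local Notation plane := 'rV[R]_2.
Implicit Types (a b u v w x y z : plane) (r s t : R) (K A : set plane).

Lemma dotE u v : dot u v = u 0 0 * v 0 0 + u 0 1 * v 0 1.
Proof.
rewrite /dot !big_ord_recl big_ord0 addr0.
by rewrite (_ : lift ord0 ord0 = 1) //; apply/val_inj.
Qed.

Lemma plane_ext u v : u 0 0 = v 0 0 -> u 0 1 = v 0 1 -> u = v.
Proof.
move=> e0 e1; apply/rowP => -[[|[|//]] i].
  by rewrite (_ : Ordinal i = 0) //; apply/val_inj.
by rewrite (_ : Ordinal i = 1) //; apply/val_inj.
Qed.

Definition rot u : plane := \row_j (if j == 0 then - u 0 1 else u 0 0).

Lemma rotE u : (rot u 0 0 = - u 0 1) * (rot u 0 1 = u 0 0).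
Proof. by rewrite !mxE. Qed.

Lemma dotC u v : dot u v = dot v u.
Proof. by rewrite !dotE; ring. Qed.

Lemma dotDr u v w : dot u (v + w) = dot u v + dot u w.
Proof. by rewrite !dotE !mxE; ring. Qed.

Lemma dotZr r u v : dot u (r *: v) = r * dot u v.
Proof. by rewrite !dotE !mxE; ring. Qed.

Lemma dotNr u v : dot u (- v) = - dot u v.
Proof. by rewrite !dotE !mxE; ring. Qed.

Lemma dotBr u v w : dot u (v - w) = dot u v - dot u w.
Proof. by rewrite dotDr dotNr. Qed.

Lemma dotDl u v w : dot (u + v) w = dot u w + dot v w.
Proof. by rewrite !(dotC _ w) dotDr. Qed.

Lemma dotZl r u v : dot (r *: u) v = r * dot u v.
Proof. by rewrite !(dotC _ v) dotZr. Qed.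

Lemma dotNl u v : dot (- u) v = - dot u v.
Proof. by rewrite !(dotC _ v) dotNr. Qed.

Lemma dotBl u v w : dot (u - v) w = dot u w - dot v w.
Proof. by rewrite !(dotC _ w) dotBr. Qed.

Lemma dot0l u : dot 0 u = 0.
Proof. by rewrite dotE !mxE; ring. Qed.

Lemma dot_rot u : dot u (rot u) = 0.
Proof. by rewrite dotE !rotE; ring. Qed.

Lemma dot_rot_rot u v : dot (rot u) (rot v) = dot u v.
Proof. by rewrite !dotE !rotE; ring. Qed.

Lemma dot_self_gt0 u : u != 0 -> 0 < dot u u.
Proof.
move=> u0; rewrite dotE -!expr2 lt_neqAle addr_ge0 ?sqr_ge0 // andbT eq_sym.
apply: contra u0; rewrite paddr_eq0 ?sqr_ge0 // !sqrf_eq0 => /andP[/eqP e0 /eqP e1].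
by apply/eqP/plane_ext; rewrite mxE.
Qed.

Lemma dot_self_neq0 u : u != 0 -> dot u u != 0.
Proof. by move=> /dot_self_gt0; rewrite lt0r => /andP[]. Qed.

Lemma rot_basis u x : u != 0 ->
  x = (dot u x / dot u u) *: u + (dot (rot u) x / dot u u) *: rot u.
Proof.
move=> /dot_self_neq0; rewrite !dotE !rotE => N0.
by apply: plane_ext; rewrite !mxE /=; field.
Qed.

Lemma dot_continuous (T : topologicalType) (f g : T -> plane) :
  continuous f -> continuous g -> continuous (fun p : T => dot (f p) (g p)).
Proof.
move=> cf cg.
have cc (h : T -> plane) i : continuous h -> continuous (fun p : T => h p 0 i).
  move=> ch p; apply: (@continuous_comp _ _ _ h (fun v : plane => v 0 i)).
    exact: ch.
  exact: coord_continuous.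
rewrite (_ : (fun=> _) = fun p : T => f p 0 0 * g p 0 0 + f p 0 1 * g p 0 1);
  last by apply/funext => p; rewrite dotE.
by move=> p; apply: cvgD; apply: cvgM; exact: cc.
Qed.

Lemma plane_convE x y (k : {i01 R}) :
  conv k (x : convex_lmodType plane) (y : convex_lmodType plane) =
  k%:num *: x + (1 - k%:num) *: y.
Proof. by []. Qed.

Lemma sub_convex_hull K : K `<=` convex_hull K.
Proof. exact: sub_gen_smallest. Qed.

Lemma convex_hull_segment K x y r s : convex_hull K x -> convex_hull K y ->
  0 <= r -> 0 <= s -> r + s = 1 -> convex_hull K (r *: x + s *: y).
Proof.
move=> Kx Ky r0 s0 rs C [convC KC].
have Cx : C x by apply: Kx.
have Cy : C y by apply: Ky.
have r1 : r <= 1 by rewrite -rs lerDl.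
have := convC x y (Itv01 r0 r1) (mem_set Cx) (mem_set Cy).
by rewrite inE plane_convE /= (_ : 1 - r = s) //; lra.
Qed.

Lemma convex_hull_dot_interval K u x (J : set R) : is_interval J ->
  (forall y, K y -> J (dot u y)) -> convex_hull K x -> J (dot u x).
Proof.
move=> itvJ KJ /(_ [set x | J (dot u x)]); apply; split => //.
move=> y z k; rewrite !inE /= plane_convE dotDr !dotZr => Jy Jz.
have k0 : 0 <= k%:num by [].
have k1 : k%:num <= 1 by [].
have [yz|/ltW zy] := leP (dot u y) (dot u z).
  by apply: (itvJ _ _ Jy Jz); apply/andP; split; nra.
by apply: (itvJ _ _ Jz Jy); apply/andP; split; nra.
Qed.

End PlaneVectors.

(** * Strict separation from the convex hull of a compact set *)

Section Separation.
Context {R : realType}.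
Local Notation plane := 'rV[R]_2.
Implicit Types (a b c d u v w x y z : plane) (r s t : R) (K A : set plane).

(** If no point of the segment from [c] to [c + d] is closer to the origin than
[c], then the squared norm cannot start by decreasing along this segment, and
its derivative at [c] is twice [dot c d]. *)
Lemma nearest_segment_slope c d :
  (forall s, 0 <= s <= 1 -> dot c c <= dot (c + s *: d) (c + s *: d)) ->
  0 <= dot c d.
Proof.
move=> min_c; rewrite leNgt; apply/negP => cd0.
set A := dot c d in cd0; set M := dot d d.
have M0 : 0 <= M by rewrite /M dotE; nra.
have expand s : dot (c + s *: d) (c + s *: d) = dot c c + s * (2 * A + s * M).
  by rewrite !dotDl !dotDr !dotZl !dotZr (dotC d c) -/A -/M; ring.
have D0 : 0 < M - A by lra.
have s0 : 0 < - A / (M - A) by apply: divr_gt0; lra.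
have s1 : - A / (M - A) <= 1 by rewrite ler_pdivrMr // mul1r; lra.
have sM : - A / (M - A) * M <= - A.
  by rewrite mulrAC ler_pdivrMr //; nra.
(* The squared norm changes by [s * (2 * A + s * M)], which is negative for this
   value of [s]: the denominator only serves to keep [s] below 1. *)
have := min_c (- A / (M - A)); rewrite expand s1 ltW // => /(_ isT); nra.
Qed.

(** A substitute for the nearest point of the convex hull, whose compactness
would require Caratheodory's theorem: the segments between two points of a
compact set form a compact family. *)
Lemma nearest_segment K p : compact K -> K !=set0 ->
  exists x y r, [/\ K x, K y, 0 <= r <= 1 &
    forall x' y' s, K x' -> K y' -> 0 <= s <= 1 ->
      dot (x + r *: (y - x) - p) (x + r *: (y - x) - p)
      <= dot (x' + s *: (y' - x') - p) (x' + s *: (y' - x') - p)].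
Proof.
move=> cK [x0 Kx0].
pose q (m : plane * plane * R) : plane := m.1.1 + m.2 *: (m.1.2 - m.1.1) - p.
have cq : continuous q.
  move=> m; apply: cvgB; last exact: cvg_cst.
  have c1 : (fun m : plane * plane * R => m.1.1) @ m --> m.1.1.
    by apply: (@cvg_comp _ _ _ fst fst); exact: cvg_fst.
  have c2 : (fun m : plane * plane * R => m.1.2) @ m --> m.1.2.
    by apply: (@cvg_comp _ _ _ fst snd); [exact: cvg_fst|exact: cvg_snd].
  by apply: cvgD => //; apply: cvgZ; [exact: cvg_snd|exact: cvgB].
have [|||m] := @compact_EVT_min _ R (fun m => dot (q m) (q m))
  (K `*` K `*` `[0, 1]).
- by exists (x0, x0, 0) => /=; rewrite in_itv /= lexx ler01.
- by do 2?apply: compact_setX => //; exact: segment_compact.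
- by apply: continuous_subspaceT; apply: dot_continuous.
case: m => -[x y] r; rewrite inE /= in_itv /= => -[[Kx Ky] r01] min.
exists x, y, r; split => // x' y' s Kx' Ky' s01.
by apply: (min (x', y', s)); rewrite inE /= in_itv.
Qed.

(** Let [c] be the vector from [p] to the nearest point of all segments with ends
in [K]; then [- c] is the normal of a separating line. Indeed, let [x] in [K] be
on the wrong side of the line through [p] orthogonal to [c]. If [p + c] is an
end of its segment, that is, a point of [K], then the segment from [p + c] to
[x] comes closer to [p]. Otherwise let [y] and [z] be the ends of its segment,
on either side of [p + c] and at right angles to [c]. If the ray from [p + c]
through [p] leaves the triangle [x y z] before [p], then it does so on the side
[x y] or [x z], at a point closer to [p]; if not, then [p] is in the triangle,
hence in the hull. *)
Lemma strict_separation K p : compact K -> K !=set0 -> ~ convex_hull K p ->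
  exists u, forall x, K x -> dot u x < dot u p.
Proof.
move=> cK K0 hullp.
have [y [z [r [Ky Kz r01 min]]]] := nearest_segment p cK K0.
set c := y + r *: (z - y) - p in min.
have hull_conv w1 w2 s : convex_hull K w1 -> convex_hull K w2 -> 0 <= s <= 1 ->
    convex_hull K (w1 + s *: (w2 - w1)).
  move=> K1 K2 /andP[s0 s1].
  rewrite (_ : _ + _ = (1 - s) *: w1 + s *: w2).
    by apply: convex_hull_segment => //; lra.
  by apply: plane_ext; rewrite !mxE; ring.
have c0 : c != 0.
  apply/eqP => c0; apply: hullp.
  rewrite (_ : p = y + r *: (z - y)); last by apply/esym/subr0_eq.
  by apply: hull_conv => //; exact: sub_convex_hull.
have N0 := dot_self_gt0 c0.
exists (- c) => x Kx; rewrite !dotNl ltrN2 -subr_gt0 -dotBr ltNge.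
apply/negP => cx0.
(* The nearest point is not in [K], as the segment to [x] would be better. *)
have vertex_case w : K w -> w - p <> c.
  move=> Kw wc.
  suff : 0 <= dot c (x - w).
    have -> : x - w = (x - p) - c.
      by rewrite -wc; apply: plane_ext; rewrite !mxE; ring.
    by rewrite dotBr; lra.
  apply: nearest_segment_slope => t t01.
  rewrite (_ : c + t *: _ = w + t *: (x - w) - p); first exact: min.
  by rewrite -wc; apply: plane_ext; rewrite !mxE; ring.
have r0 : 0 < r.
  rewrite lt_neqAle (proj1 (andP r01)) andbT eq_sym; apply/eqP => r0.
  by apply: (vertex_case _ Ky); rewrite /c r0; apply: plane_ext; rewrite !mxE; ring.
have r1 : r < 1.
  rewrite lt_neqAle (proj2 (andP r01)) andbT; apply/eqP => r1.
  by apply: (vertex_case _ Kz); rewrite /c r1; apply: plane_ext; rewrite !mxE; ring.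
pose k : plane := y - p - c.
have k0 : k != 0 by rewrite /k subr_eq0; apply/eqP/vertex_case.
have yE : y = p + c + k by apply: plane_ext; rewrite !mxE; ring.
have zE : z = p + c - ((1 - r) / r) *: k.
  by rewrite /k /c; apply: plane_ext; rewrite !mxE; field; rewrite gt_eqF.
set b := (1 - r) / r in zE.
have b0 : 0 < b by apply: divr_gt0 => //; lra.
have ck0 : dot c k = 0.
  have kmin t : 0 <= r - t * r <= 1 -> dot c c <= dot (c + t *: k) (c + t *: k).
    move=> t01; rewrite (_ : c + t *: k = y + (r - t * r) *: (z - y) - p).
      exact: min.
    by rewrite /k /c; apply: plane_ext; rewrite !mxE; ring.
  apply/eqP; rewrite eq_le; apply/andP; split.
    rewrite -oppr_ge0 -(pmulr_rge0 _ b0) -dotNr -dotZr.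
    apply: nearest_segment_slope => s /andP[s0 s1].
    rewrite 2!scalerN scalerA -scaleNr; apply: kmin.
    rewrite (_ : r - _ = r + s * (1 - r)); last by rewrite /b; field; rewrite gt_eqF.
    by nra.
  by apply: nearest_segment_slope => s /andP[s0 s1]; apply: kmin; nra.
have [al kE] : exists al, k = al *: rot c.
  exists (dot (rot c) k / dot c c).
  by have := rot_basis k c0; rewrite ck0 mul0r scale0r add0r.
have al0 : al != 0 by apply: contra k0 => /eqP al0; rewrite kE al0 scale0r.
set la := - (dot c (x - p) / dot c c).
have la0 : 0 <= la by rewrite /la -mulNr divr_ge0 ?oppr_ge0 // ltW.
pose mu := dot (rot c) (x - p) / dot c c / al.
have xE : x = p - la *: c + mu *: k.
  rewrite {1}(_ : x = p + (x - p)); last by rewrite addrC subrK.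
  rewrite {1}(rot_basis (x - p) c0) kE /la /mu scaleNr opprK scalerA divfK //.
  by rewrite addrA.
clearbody la mu.
(* If [w] and [x] are at opposite sides of the axis [p + R c], with [x] so far that
   the segment from [x] to [w] meets the axis beyond [p], then the meeting point
   is closer to [p] than [p + c]. Used for [w := z] and, mirrored, [w := y]. *)
have closer w e k' m : K w -> 0 < e -> w = p + c - e *: k' ->
    x = p - la *: c + m *: k' -> m <= la * e.
  move=> Kw e0 wE xE'; rewrite leNgt; apply/negP => lem.
  have m0 : 0 < m by apply: le_lt_trans lem; rewrite mulr_ge0 // ltW.
  have s01 : 0 <= m / (e + m) <= 1.
    rewrite divr_ge0 ?addr_ge0 ?(ltW e0) ?(ltW m0) //= ler_pdivrMr ?addr_gt0 //.
    by rewrite mul1r lerDr (ltW e0).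
  have := min _ _ _ Kx Kw s01.
  rewrite (_ : x + _ - p = ((m - la * e) / (e + m)) *: c); last first.
    rewrite wE xE'; apply: plane_ext; rewrite !mxE; field;
    by rewrite gt_eqF ?addr_gt0.
  set sg := _ / _.
  have em0 := addr_gt0 e0 m0.
  have sg0 : 0 < sg by rewrite divr_gt0 ?subr_gt0.
  have sg1 : sg < 1 by rewrite ltr_pdivrMr //; nra.
  rewrite dotZl dotZr; have : 0 < (1 - sg) * (1 + sg) by nra.
  by nra.
have mu_le : mu <= la * b by apply: (closer z b k).
have mu_ge : - mu <= la * 1.
  apply: (closer y 1 (- k)) => //.
    by rewrite scale1r opprK.
  by rewrite scalerN scaleNr opprK.
(* Now [p] is in the triangle: it is between the points at which the line through
   [p] parallel to [y z] meets the sides [x z] and [x y]. *)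
apply: hullp.
have hx := sub_convex_hull Kx.
have hy := sub_convex_hull Ky; have hz := sub_convex_hull Kz.
have [la1|la1] := eqVneq la 0.
  move: mu_le mu_ge; rewrite la1 !mul0r => mu_le mu_ge.
  rewrite (_ : p = x) // xE la1 (_ : mu = 0); last lra.
  by rewrite !scale0r subr0 addr0.
have {}la0 : 0 < la by rewrite lt_neqAle eq_sym la1.
have lb0 : 0 < la * b by rewrite mulr_gt0.
have L0 : 0 < 1 + la by lra.
have I0 : 0 <= la / (1 + la) <= 1.
  by rewrite divr_ge0 ?(ltW L0) ?(ltW la0) //= ler_pdivrMr //; lra.
have J0 : 0 <= (la * b - mu) / (la * b + la) <= 1.
  rewrite divr_ge0 ?subr_ge0 ?addr_ge0 ?(ltW lb0) ?(ltW la0) //=.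
  by rewrite ler_pdivrMr; lra.
rewrite (_ : p = (x + (la / (1 + la)) *: (z - x)) + ((la * b - mu) / (la * b + la))
   *: ((x + (la / (1 + la)) *: (y - x)) - (x + (la / (1 + la)) *: (z - x)))).
  by apply: (hull_conv) => //; apply: hull_conv.
rewrite yE zE xE; apply: plane_ext; rewrite !mxE; field.
- by rewrite !gt_eqF // -?mulrDr ?mulr_gt0; lra.
- by rewrite !gt_eqF // -?mulrDr ?mulr_gt0; lra.
Qed.

End Separation.

(** * Counting the zeros of a continuous function on a line *)

Section ZerosOnLine.
Context {R : realType}.
Implicit Types (F : R -> R) (a b x y z r s : R).

Lemma zero_between F x y : continuous F -> x <= y -> F x * F y <= 0 ->
  exists2 z, x <= z <= y & F z = 0.
Proof.
move=> cF xy Fxy.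
have [||z zxy Fz] := @IVT R F x y 0 xy; first exact: continuous_subspaceT.
  rewrite ge_min le_max.
  have [Fx|Fx] := leP (F x) 0; have [Fy|Fy] := leP (F y) 0;
    rewrite ?(ltW Fx) ?(ltW Fy) ?orbT //=.
    by have [-> | ->] : F x = 0 \/ F y = 0; [|rewrite lexx..]; nra.
  by nra.
by exists z => //; move: zxy; rewrite in_itv.
Qed.

(** Each of the consecutive sign changes recorded in [xs] gives a zero. One more
is found when the parity of the number of sign changes disagrees with the signs
of [F a] and [F b], since then some sign change is not recorded. The induction
moves [a] to the end [y] of the first interval: if [F] does not change sign
between [a] and the start [x], then the sign at [y] is opposite to that at [a],
and the disagreement persists on the interval from [y] to [b]; otherwise there
is an extra zero before [x]. *)
Lemma zeros_of_sign_changes F (a b : R) (xs : seq (R * R)) :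
  continuous F -> a <= b ->
  (forall p, p \in xs -> [/\ a <= p.1, p.1 < p.2, p.2 <= b & F p.1 * F p.2 < 0]) ->
  pairwise (fun p q => p.2 <= q.1) xs ->
  exists zs : seq R, [/\ uniq zs,
    forall z, z \in zs -> a <= z <= b /\ F z = 0
    & (size xs + (F a * F b * (-1) ^+ size xs < 0)%R <= size zs)%N].
Proof.
move=> cF; elim: xs a => [a ab _ _|[x y] xs IH a ab H] /=.
  rewrite mulr1; have [Fab|_] := boolP (F a * F b < 0); last by exists [::].
  have [z zab Fz] := zero_between cF ab (ltW Fab).
  by exists [:: z]; split => // w; rewrite inE => /eqP->.
move=> /andP[/allP yxs pxs].
have [/= ax xy yb Fxy] := H _ (mem_head _ _).
have [zs [uzs zsP szs]] : exists zs : seq R, [/\ uniq zs,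
    forall z, z \in zs -> y <= z <= b /\ F z = 0
    & (size xs + (F y * F b * (-1) ^+ size xs < 0)%R <= size zs)%N].
  apply: IH => // q qxs; have [|_ ? ? ?] := H q; first by rewrite inE qxs orbT.
  by split => //; exact: yxs.
have y_lt z : z \in zs -> y < z.
  move=> /zsP[/andP[yz _] Fz]; rewrite lt_neqAle yz andbT.
  by apply/eqP => yEz; move: Fxy; rewrite yEz Fz mulr0 ltxx.
have [z0 /andP[xz0 z0y] Fz0] := zero_between cF (ltW xy) (ltW Fxy).
have z0y' : z0 < y.
  by rewrite lt_neqAle z0y andbT; apply/eqP => e; move: Fxy; rewrite -e Fz0 mulr0 ltxx.
have xz0' : x < z0.
  by rewrite lt_neqAle xz0 andbT; apply/eqP => e; move: Fxy; rewrite e Fz0 mul0r ltxx.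
have z0zs : z0 \notin zs by apply/negP => /y_lt; rewrite ltNge (ltW z0y').
have z0zsP z : z \in z0 :: zs -> x < z /\ F z = 0 /\ z <= b.
  rewrite inE => /predU1P[->|zzs]; first by split => //; split => //; lra.
  by have [/andP[_ zb] Fz] := zsP _ zzs; split => //; have := y_lt _ zzs; lra.
have small : (size xs < size (z0 :: zs))%N by apply: leq_trans szs; exact: leq_addr.
have rangeP z : z \in z0 :: zs -> a <= z <= b /\ F z = 0.
  by move=> /z0zsP [? [? ?]]; split => //; apply/andP; split => //; lra.
case: ltP => [odd_sign|_]; last first.
  by exists (z0 :: zs); split => //=; [rewrite z0zs|rewrite addn0].
have [Fax|Fax] := leP (F a * F x) 0.
  have [z1 /andP[az1 z1x] Fz1] := zero_between cF ax Fax.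
  exists [:: z1, z0 & zs]; split => [|z|]; last by rewrite addn1.
    rewrite cons_uniq /= z0zs uzs !andbT.
    by apply/negP => /z0zsP[]; rewrite ltNge z1x.
  by rewrite inE => /predU1P[->|/rangeP//]; split => //; apply/andP; split => //; lra.
exists (z0 :: zs); split => //=; first by rewrite z0zs.
rewrite addSn ltnS; apply: leq_trans szs; rewrite leq_add2l.
suff -> : F y * F b * (-1) ^+ size xs < 0 by [].
rewrite -mulrA; set w := F b * _.
have aw : 0 < F a * w.
  by move: odd_sign; rewrite exprS mulN1r mulrN oppr_lt0 -mulrA.
rewrite -(pmulr_rlt0 (F y * w) (_ : 0 < F a ^+ 2)); last first.
  by rewrite exprn_even_gt0 //=; apply/eqP => e; move: Fax; rewrite e mul0r ltxx.
have -> : F a ^+ 2 * (F y * w) = (F a * F y) * (F a * w) by ring.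
have : F a * F y < 0.
  have : (F a * F x) * (F x * F y) < 0 by nra.
  have -> : (F a * F x) * (F x * F y) = F x ^+ 2 * (F a * F y) by ring.
  rewrite pmulr_rlt0 // exprn_even_gt0 //=; apply/eqP => e.
  by move: Fax; rewrite e mulr0 ltxx.
by nra.
Qed.

(** Disjoint intervals of a line come in a definite order, that of any points
chosen in them, so the sign changes found in them can be sorted. *)
Lemma zeros_of_disjoint_intervals n (F : R -> R) (a b : R)
    (I : 'I_n -> set R) :
  continuous F -> a <= b ->
  (forall i, is_interval (I i)) ->
  (forall i j z, I i z -> I j z -> i = j) ->
  (forall i, exists x y, [/\ I i x, I i y, a <= x <= b, a <= y <= b
     & F x * F y < 0]) ->
  exists zs : seq R, [/\ uniq zs,
    forall z, z \in zs -> a <= z <= b /\ F z = 0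
    & (n + (F a * F b * (-1) ^+ n < 0)%R <= size zs)%N].
Proof.
move=> cF ab itvI disj sgnI.
have /choice [p pP] : forall i, exists p : R * R, [/\ I i p.1, I i p.2 &
    [/\ a <= p.1, p.1 < p.2, p.2 <= b & F p.1 * F p.2 < 0]].
  move=> i; have [x [y [Ix Iy /andP[ax xb] /andP[ay yb] Fxy]]] := sgnI i.
  have [xy|yx|xy] := ltgtP x y; first by exists (x, y).
    by exists (y, x); split => //=; rewrite mulrC.
  by move: Fxy; rewrite xy -expr2 ltNge sqr_ge0.
pose r := [rel i j | (p i).1 <= (p j).1].
have rtot : total r by move=> i j; exact: le_total.
have rtrans : transitive r by move=> i j k; exact: le_trans.
pose s := sort r (enum 'I_n).
have ss : size s = n by rewrite size_sort size_enum_ord.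
have us : uniq s by rewrite sort_uniq enum_uniq.
have ps : pairwise r s by rewrite -sorted_pairwise // sort_sorted.
rewrite -[in X in (X + _)%N]ss -[in X in _ ^+ X]ss -(size_map p).
apply: zeros_of_sign_changes => //.
  by move=> q /mapP[i _ ->]; have [] := pP i.
rewrite pairwise_map.
elim: (s) us ps => //= i t IH /andP[it ut] /andP[/allP it_le pt].
rewrite IH // andbT; apply/allP => j jt /=; rewrite leNgt; apply/negP => ji.
have [Ij1 _ _] := pP j; have [Ii1 Ii2 _] := pP i.
have Iij : I i (p j).1.
  by apply: (itvI i _ _ Ii1 Ii2); rewrite (ltW ji) andbT; exact: it_le.
by move: it; rewrite (disj _ _ _ Iij Ij1) jt.
Qed.

End ZerosOnLine.

(** * Support functions *)

Section SupportFunction.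
Context {R : realType}.
Local Notation plane := 'rV[R]_2.
Implicit Types (a b c d u v w x y z : plane) (r s t : R) (K A : set plane).

Definition support_fun K u : R := sup [set dot u x | x in K].

Lemma support_fun_attained K u : compact K -> K !=set0 ->
  exists2 x, K x & support_fun K u = dot u x /\ forall y, K y -> dot u y <= dot u x.
Proof.
move=> cK K0.
have [|x Kx max] := @compact_EVT_max _ R (dot u) K K0 cK.
  apply: continuous_subspaceT; apply: (@dot_continuous _ _ (fun=> u) id).
    exact: cst_continuous.
  by move=> p; exact: cvg_id.
exists x; first by rewrite inE in Kx.
have max' y : K y -> dot u y <= dot u x by move=> Ky; apply: max; rewrite inE.
split => //; apply/eqP; rewrite eq_le; apply/andP; split.
  apply: ge_sup; first by case: K0 => y Ky; exists (dot u y); exists y.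
  by move=> _ [y Ky <-]; exact: max'.
apply: ub_le_sup; last by exists x => //; rewrite inE in Kx.
by exists (dot u x) => _ [y Ky <-]; exact: max'.
Qed.

Lemma support_fun_ub K u x : compact K -> K x -> dot u x <= support_fun K u.
Proof.
by move=> cK Kx; have [||y Ky [-> ]] := @support_fun_attained K u; [|exists x|apply].
Qed.

Lemma support_funZ K r u : compact K -> K !=set0 -> 0 < r ->
  support_fun K (r *: u) = r * support_fun K u.
Proof.
move=> cK K0 r0.
have [x Kx [-> maxx]] := support_fun_attained u cK K0.
have [y Ky [-> maxy]] := support_fun_attained (r *: u) cK K0.
apply/eqP; rewrite eq_le -[in X in _ && X]dotZl maxy // andbT.
by rewrite dotZl ler_pM2l // maxx.
Qed.

Lemma coord_le_mx_norm u i : `|u 0 i| <= `|u|.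
Proof.
rewrite [leRHS]mx_normrE.
exact: (le_bigmax _ (fun ij => `|u ij.1 ij.2|) (0, i)).
Qed.

Lemma dot_le_mx_norm u v : dot u v <= `|u| * `|v| *+ 2.
Proof.
rewrite dotE mulr2n lerD //; apply: le_trans (ler_norm _) _;
by rewrite normrM ler_pM ?coord_le_mx_norm.
Qed.

(** A point at which the support is attained for [u] bounds the support for [v]
from below, so the two supports differ by at most [dot (u - v) x]. *)
Lemma support_fun_lipschitz K : compact K -> K !=set0 ->
  exists M : R, forall u v,
  `|support_fun K u - support_fun K v| <= M * `|u - v|.
Proof.
move=> cK K0.
have [|m Km max] := @compact_EVT_max plane R (fun x => `|x|) K K0 cK.
  by apply: continuous_subspaceT; exact: norm_continuous.
have bound u v : support_fun K u - support_fun K v <= `|m| *+ 2 * `|u - v|.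
  have [x Kx [-> _]] := support_fun_attained u cK K0.
  have := support_fun_ub v cK Kx.
  suff : dot u x - dot v x <= `|m| *+ 2 * `|u - v| by lra.
  rewrite -dotBl; apply: le_trans (dot_le_mx_norm _ _) _.
  by rewrite mulrnAl ler_pMn2r // mulrC ler_wpM2r // max // inE.
exists (`|m| *+ 2) => u v; rewrite ler_norml bound andbT.
by rewrite lerNl opprB distrC bound.
Qed.

Lemma support_fun_continuous K : compact K -> K !=set0 ->
  continuous (support_fun K).
Proof.
move=> cK K0 u; have [M HM] := support_fun_lipschitz cK K0.
apply/(@cvgrPdist_le _ _ _ (nbhs u)) => /= e e0.
have M0 : 0 < `|M| + 1 by rewrite ltr_wpDl.
have /cvgrPdist_le/(_ _ (divr_gt0 e0 M0)) : (id : plane -> plane) @ u --> u.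
  exact: cvg_id.
apply: (@filterS _ (nbhs u) (nbhs_filter u)) => v /=; rewrite ler_pdivlMr // mulrC => uv.
apply: le_trans (HM u v) (le_trans _ uv).
by rewrite ler_wpM2r // (le_trans (ler_norm M)) // lerDl.
Qed.

End SupportFunction.

(** * Normal cones and stereographic projection of the directions *)

Section Cones.
Context {R : realType}.
Local Notation plane := 'rV[R]_2.
Implicit Types (a b c d u v w x y z e : plane) (r s t : R) (K A C : set plane).

(** The apex is allowed to be missing: the cones below are open and omit 0. *)
Definition convex_cone C := forall u v r s,
  C u -> C v -> 0 <= r -> 0 <= s -> 0 < r + s -> C (r *: u + s *: v).

Lemma convex_coneZ C u r : convex_cone C -> C u -> 0 < r -> C (r *: u).
Proof.
move=> convC Cu r0; have := convC u u r 0 Cu Cu (ltW r0) (lexx 0).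
by rewrite scale0r !addr0; apply.
Qed.

(** For distinct points, the interior of the usual normal cone of the convex hull
at [G i]; it is empty when [G i] is not an extreme point of the hull. *)
Definition normal_cone n (G : 'I_n -> plane) (i : 'I_n) : set plane :=
  [set u | forall k, k != i -> dot u (G k) < dot u (G i)].

Lemma normal_cone_convex n (G : 'I_n -> plane) i : convex_cone (normal_cone G i).
Proof.
move=> u v r s Cu Cv r0 s0 rs k ki; rewrite !dotDl !dotZl.
have Du := Cu k ki; have Dv := Cv k ki.
have [r0'|r0'] := ltrP 0 r.
  by rewrite ltr_leD ?ltr_pM2l // ler_wpM2l // ltW.
have s0' : 0 < s by lra.
by rewrite ler_ltD ?ltr_pM2l // ler_wpM2l // ltW.
Qed.

Lemma normal_cone_disjoint n (G : 'I_n -> plane) i j u :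
  normal_cone G i u -> normal_cone G j u -> i = j.
Proof.
move=> Ci Cj; apply/eqP; apply: contraT => ij.
have := lt_trans (Cj _ ij) (Ci j _); rewrite ltxx eq_sym; exact.
Qed.

Lemma normal_cone_nonzero n (G : 'I_n -> plane) i : (1 < n)%N ->
  ~ normal_cone G i 0.
Proof.
move=> n1; have /existsP[k ki] : [exists k : 'I_n, k != i].
  rewrite -negb_forall; apply/negP => /forallP H.
  have : (#|'I_n| <= 1)%N by apply/fintype_le1P => x y; rewrite (eqP (H x)) (eqP (H y)).
  by rewrite card_ord leqNgt n1.
by move=> /(_ k ki); rewrite !dot0l ltxx.
Qed.

(** Moving from [a] to [b], compare the height of [G i] with the support function
of the other vertices: [G i] is strictly higher at first and strictly lower in
the end. When the two heights agree, [G i] and another vertex are both highest,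
so that the direction is in no normal cone. *)
Lemma tie_on_segment n (G : 'I_n -> plane) i j a b : i != j ->
  normal_cone G i a -> normal_cone G j b ->
  exists2 t, 0 <= t <= 1 & forall k, ~ normal_cone G k (a + t *: (b - a)).
Proof.
move=> ij Ca Cb; pose K := G @` [set k | k != i].
have cK : compact K.
  by apply: finite_compact; apply: finite_image; exact: finite_finset.
have K0 : K !=set0 by exists (G j); exists j => //=; rewrite eq_sym.
pose e t := a + t *: (b - a).
have ce : continuous e.
  move=> t; apply: cvgD; first exact: cvg_cst.
  by apply: cvgZr_tmp; exact: cvg_id.
pose g t := support_fun K (e t) - dot (e t) (G i).
have cg : continuous g.
  move=> t; apply: cvgB.
    by apply: (@continuous_comp _ _ _ e); [exact: ce|exact: support_fun_continuous].
  by apply: (@dot_continuous _ _ e (fun=> G i)) => //; exact: cst_continuous.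
have [||t t01 gt0] := @zero_between R g 0 1 cg => //.
  rewrite /g /e scale0r addr0 scale1r (addrC a) subrK.
  have [_ [k ki <-] [-> _]] := support_fun_attained a cK K0.
  have := @support_fun_ub _ K b (G j) cK; have := Ca k ki; have := Cb i ij.
  suff Kj : K (G j) by move=> h1 h2 /(_ Kj) h3; nra.
  by exists j => //=; rewrite eq_sym.
exists t => // k Ck; move: gt0; rewrite /g.
have [_ [m mi <-] [-> maxm]] := support_fun_attained (e t) cK K0 => /eqP.
rewrite subr_eq0 => /eqP tie.
have [ki|ki] := eqVneq k i.
  by have := Ck m; rewrite ki mi => /(_ isT); rewrite -/(e t) tie ltxx.
have := Ck i; rewrite eq_sym ki => /(_ isT); rewrite -/(e t) -tie.
by rewrite ltNge maxm //; exists k.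
Qed.

(** The tie direction on a segment is useless only if it is 0, that is, if the ends
of the segment are opposite directions. With three cones this cannot happen for
two consecutive segments [a b] and [b c], since then [a] and [c] would be on the
same ray. *)
Lemma tie_direction n (G : 'I_n -> plane) : (3 <= n)%N ->
  (forall i, normal_cone G i !=set0) ->
  exists2 e, e != 0 & forall i, ~ normal_cone G i e.
Proof.
move=> n3 N0; case: n n3 G N0 => [|[|[|n]]] // _ G N0.
pose i : 'I_n.+3 := Ordinal (isT : (0 < n.+3)%N).
pose j : 'I_n.+3 := Ordinal (isT : (1 < n.+3)%N).
pose k : 'I_n.+3 := Ordinal (isT : (2 < n.+3)%N).
have [a Na] := N0 i; have [b Nb] := N0 j; have [c Nc] := N0 k.
have [t /andP[t0 t1] He] := @tie_on_segment _ _ i j _ _ isT Na Nb.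
have [e0|] := eqVneq (a + t *: (b - a)) 0; last by exists (a + t *: (b - a)).
have [s /andP[s0 s1] He'] := @tie_on_segment _ _ j k _ _ isT Nb Nc.
have [e'0|] := eqVneq (b + s *: (c - b)) 0; last by exists (b + s *: (c - b)).
have inner l m (u v : plane) r : normal_cone G l u -> normal_cone G m v ->
    0 <= r -> r <= 1 -> u + r *: (v - u) = 0 -> 0 < r < 1.
  move=> Nu Nv r0 r1 e0'; rewrite !lt_neqAle r0 r1 !andbT eq_sym.
  apply/andP; split; apply/eqP => re; move: e0'; rewrite re.
    rewrite scale0r addr0 => u0; rewrite u0 in Nu.
    exact: normal_cone_nonzero Nu.
  rewrite scale1r addrC subrK => v0; rewrite v0 in Nv.
  exact: normal_cone_nonzero Nv.
have /andP[{}t0 {}t1] := inner _ _ _ _ _ Na Nb t0 t1 e0.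
have /andP[{}s0 {}s1] := inner _ _ _ _ _ Nb Nc s0 s1 e'0.
suff : i = k by [].
apply: (@normal_cone_disjoint _ G _ _ ((t * s) *: c)); last first.
  by apply: (convex_coneZ (@normal_cone_convex _ G k)); rewrite ?mulr_gt0.
have -> : (t * s) *: c = ((1 - t) * (1 - s)) *: a.
  apply/eqP; rewrite -subr_eq0; apply/eqP.
  transitivity (t *: (b + s *: (c - b)) - (1 - s) *: (a + t *: (b - a))).
    by apply: plane_ext; rewrite !mxE; ring.
  by rewrite e0 e'0 !scaler0 subr0.
by apply: (convex_coneZ (@normal_cone_convex _ G i)); rewrite ?mulr_gt0 ?subr_gt0.
Qed.

(** Stereographic projection of the circle of directions from the pole [e]: the
direction of [stereo e t] runs through all directions except that of [e], once
each, and tends to that of [e] when [t] tends to either infinity. The vectors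
are not normalized, in order to keep the formula polynomial. *)
Definition stereo e t : plane := (2 * t) *: rot e + (t ^+ 2 - 1) *: e.

Lemma stereo_continuous e : continuous (stereo e).
Proof.
move=> t; apply: cvgD; apply: cvgZr_tmp.
  by apply: cvgM; [exact: cvg_cst|exact: cvg_id].
by apply: cvgB; [exact: exprn_continuous|exact: cvg_cst].
Qed.

Lemma rot_basis_inj e (p q p' q' : R) : e != 0 ->
  p *: rot e + q *: e = p' *: rot e + q' *: e -> p = p' /\ q = q'.
Proof.
move=> /dot_self_neq0 N0 E; split; apply: (mulIf N0).
  have := congr1 (dot (rot e)) E.
  by rewrite !dotDr !dotZr !(dotC (rot e) e) dot_rot !mulr0 !addr0 dot_rot_rot.
have := congr1 (dot e) E.
by rewrite !dotDr !dotZr dot_rot !mulr0 !add0r.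
Qed.

Lemma stereo_inj e r t t' : e != 0 -> 0 < r ->
  stereo e t = r *: stereo e t' -> t = t'.
Proof.
move=> e0 r0; rewrite /stereo scalerDr !scalerA => /rot_basis_inj -/(_ e0)[E1 E2].
have {E1} E1 : t = r * t' by lra.
move: E2; rewrite E1 => E2.
have /eqP : (r - 1) * (1 + r * t' ^+ 2) = 0 by nra.
rewrite mulf_eq0 => /orP[/eqP|/eqP] E; last by have := sqr_ge0 t'; nra.
have -> : r = 1 by lra.
by rewrite mul1r.
Qed.

Lemma stereo_neq_pole e r t : e != 0 -> 0 <= r -> stereo e t <> r *: e.
Proof.
move=> e0 r0 E.
have := @rot_basis_inj e (2 * t) (t ^+ 2 - 1) 0 r e0.
by rewrite scale0r add0r => /(_ E)[]; nra.
Qed.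

Lemma stereo_surj e u : e != 0 -> (forall r, 0 <= r -> u <> r *: e) ->
  exists t r, 0 < r /\ stereo e t = r *: u.
Proof.
move=> e0 ue; rewrite (rot_basis u e0).
set be := _ / _; set al := dot (rot e) u / _.
set rho := Num.sqrt (al ^+ 2 + be ^+ 2).
have rho2 : rho ^+ 2 = al ^+ 2 + be ^+ 2.
  by rewrite sqr_sqrtr // addr_ge0 ?sqr_ge0.
have rho0 : 0 <= rho by exact: sqrtr_ge0.
have D0 : 0 < rho - be.
  rewrite ltNge; apply/negP => rb.
  have al0 : al = 0 by apply/eqP; rewrite -sqrf_eq0; apply/eqP; have := sqr_ge0 al; nra.
  apply: (ue be); first by lra.
  by rewrite [LHS](rot_basis u e0) -/al al0 scale0r addr0.
(* In the basis [rot e], [e], the point [(al, be) / rho] of the unit circle is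
   projected from [(0, 1)] to the axis spanned by [rot e]. *)
exists (al / (rho - be)), (2 / (rho - be)); split; first by rewrite divr_gt0.
rewrite /stereo addrC scalerDr !scalerA; congr (_ *: _ + _ *: _).
  have al2 : al ^+ 2 = (rho - be) ^+ 2 + 2 * be * (rho - be).
    by rewrite (_ : al ^+ 2 = rho ^+ 2 - be ^+ 2); [ring|rewrite rho2 addrK].
  by rewrite expr_div_n al2; field; rewrite gt_eqF.
by field; rewrite gt_eqF.
Qed.

(** A convex cone that misses the pole is an arc of the cut circle. For a direction
[t] between [t1] and [t2], the sign of [1 + t1 * t2] tells whether the angle from
[t1] to [t2] on the side of [t] is less than two right angles. If so, [stereo e t]
is a positive combination of the two ends; if not, a nonnegative multiple of [e]
is one. *)
Lemma stereo_cone_interval C e : convex_cone C ->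
  (forall r, 0 <= r -> ~ C (r *: e)) -> is_interval [set t | C (stereo e t)].
Proof.
move=> convC Ce t1 t2 /= C1 C2 t /andP[].
rewrite le_eqVlt => /predU1P[<- //|t1t].
rewrite le_eqVlt => /predU1P[-> //|tt2].
have t12 := lt_trans t1t tt2.
have D0 : 0 < 1 + t1 * t2.
  rewrite ltNge; apply/negP => D0.
  have t1_lt0 : t1 < 0 by nra.
  have t2_gt0 : 0 < t2 by nra.
  apply: (Ce ((t1 - t2) * (1 + t1 * t2))); first by nra.
  have -> : ((t1 - t2) * (1 + t1 * t2)) *: e = t2 *: stereo e t1 + (- t1) *: stereo e t2.
    by apply: plane_ext; rewrite !mxE; ring.
  by apply: convC => //; lra.
have t21 : 0 < t2 - t1 by rewrite subr_gt0.
have Da : 0 < 1 + t * t2.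
  rewrite -(pmulr_rgt0 _ t21).
  have -> : (t2 - t1) * (1 + t * t2) =
    (t2 - t) * (1 + t1 * t2) + (t - t1) * (1 + t2 ^+ 2) by ring.
  by apply: addr_gt0; apply: mulr_gt0; rewrite ?subr_gt0 // ltr_wpDr ?sqr_ge0.
have Db : 0 < 1 + t1 * t.
  rewrite -(pmulr_rgt0 _ t21).
  have -> : (t2 - t1) * (1 + t1 * t) =
    (t - t1) * (1 + t1 * t2) + (t2 - t) * (1 + t1 ^+ 2) by ring.
  by apply: addr_gt0; apply: mulr_gt0; rewrite ?subr_gt0 // ltr_wpDr ?sqr_ge0.
pose r := (t2 - t) * (1 + t * t2); pose s := (t - t1) * (1 + t1 * t).
have rsE : r *: stereo e t1 + s *: stereo e t2 =
    ((t2 - t1) * (1 + t1 * t2)) *: stereo e t.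
  by rewrite /r /s; apply: plane_ext; rewrite !mxE; ring.
have r0 : 0 < r by rewrite mulr_gt0 // subr_gt0.
have s0 : 0 < s by rewrite mulr_gt0 // subr_gt0.
have q0 : 0 < (t2 - t1) * (1 + t1 * t2) by rewrite mulr_gt0.
have := convex_coneZ convC (convC _ _ r s C1 C2 (ltW r0) (ltW s0) (addr_gt0 r0 s0))
  (_ : 0 < ((t2 - t1) * (1 + t1 * t2))^-1).
by rewrite invr_gt0 rsE scalerA mulVf ?gt_eqF // scale1r; apply.
Qed.

End Cones.

(** * Zeros of a positively homogeneous function on the plane *)

Section ZeroDirections.
Context {R : realType}.
Local Notation plane := 'rV[R]_2.
Implicit Types (a b c d u v w x y z e : plane) (r s t : R) (K A C : set plane)
  (f : plane -> R).

(** After division by the square of [t], [stereo e t] tends to [e] at both infinite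
ends, as a continuous function of the inverse of [t]. *)
Lemma stereo_far f e : continuous f ->
  (forall r u, 0 < r -> f (r *: u) = r * f u) -> f e != 0 ->
  exists2 T, 0 < T & forall t, T <= `|t| -> 0 < f (stereo e t) * f e.
Proof.
move=> cf homf fe0.
pose v s : plane := (2 * s) *: rot e + (1 - s ^+ 2) *: e.
have cv : continuous v.
  move=> s; apply: cvgD; apply: cvgZr_tmp.
    by apply: cvgM; [exact: cvg_cst|exact: cvg_id].
  by apply: cvgB; [exact: cvg_cst|exact: exprn_continuous].
pose g s := f (v s) * f e.
have cg : g @ (0 : R) --> g 0.
  apply: cvgM; last exact: cvg_cst.
  by apply: (@continuous_comp _ _ _ v); [exact: cv|exact: cf].
have g0 : 0 < g 0.
  have -> : g 0 = f e ^+ 2.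
    by rewrite /g /v mulr0 scale0r add0r expr0n subr0 scale1r.
  by rewrite exprn_even_gt0.
have near_pos : nbhs (0 : R) [set s | 0 < g s] by exact: (cvgr_gt (g 0) cg).
have /nbhs_ballP[eps /= eps0 near0] := near_pos.
exists (2 / eps) => [|t]; first by rewrite divr_gt0.
rewrite ler_pdivrMr // => teps.
have t0 : t != 0 by apply/eqP => t0; move: teps; rewrite t0 normr0 mul0r; lra.
have := near0 t^-1; rewrite -ball_normE /= sub0r normrN normfV.
have nt0 : 0 < `|t| by rewrite normr_gt0.
rewrite -[_ < eps](ltr_pM2l nt0) mulfV ?gt_eqF // => /(_ _) gt0.
have -> : stereo e t = t ^+ 2 *: v t^-1.
  by rewrite /stereo /v; apply: plane_ext; rewrite !mxE; field.
rewrite homf ?exprn_even_gt0 // -mulrA mulr_gt0 ?exprn_even_gt0 //.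
by apply: gt0; lra.
Qed.

(** The last property says that the zeros are on different rays. In the coordinate
given by the stereographic projection from [e], there are [n] disjoint intervals
with a sign change each. If [f e != 0], then [f] has the sign of [f e] far away
on both sides, so that for odd [n] the parity gives one more zero; if [f e = 0],
then [e] itself is one more zero. *)
Lemma zero_directions n (C : 'I_n -> set plane) f e :
  continuous f -> (forall r u, 0 < r -> f (r *: u) = r * f u) ->
  (forall i, convex_cone (C i)) ->
  (forall i j u, C i u -> C j u -> i = j) ->
  (forall i, exists u v, [/\ C i u, C i v, 0 < f u & f v < 0]) ->
  e != 0 -> (forall i r, 0 <= r -> ~ C i (r *: e)) ->
  exists us : seq plane, [/\ uniq us, (n + odd n <= size us)%N,
    forall u, u \in us -> u != 0 /\ f u = 0 &
    forall u v r, u \in us -> v \in us -> 0 < r -> u = r *: v -> u = v].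
Proof.
move=> cf homf convC disj signs e0 Ce.
pose F t := f (stereo e t).
have cF : continuous F.
  move=> t; apply: (@continuous_comp _ _ _ (stereo e)); last exact: cf.
  exact: stereo_continuous.
have stereo_ne0 t : stereo e t != 0.
  by apply/eqP => h; apply: (@stereo_neq_pole R e 0 t) => //; rewrite scale0r.
have param i u : C i u -> exists t r, 0 < r /\ stereo e t = r *: u.
  by move=> Cu; apply: stereo_surj => // r r0 uE; apply: (Ce i r r0); rewrite -uE.
have /choice [p pP] : forall i, exists p : R * R,
    [/\ C i (stereo e p.1), C i (stereo e p.2) & F p.1 * F p.2 < 0].
  move=> i; have [u [v [Cu Cv fu fv]]] := signs i.
  have [t [r [r0 tE]]] := param _ _ Cu; have [t' [r' [r'0 t'E]]] := param _ _ Cv.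
  exists (t, t'); rewrite /F /= tE t'E; split; try exact: convex_coneZ.
  by rewrite !homf // pmulr_rlt0 ?mulr_gt0 // pmulr_rlt0.
(* A symmetric interval that contains all the points chosen so far. *)
have bounded (T : R) : exists b : R, [/\ T <= b, 0 <= b & forall i,
    -b <= (p i).1 <= b /\ -b <= (p i).2 <= b].
  pose S := \sum_i (`|(p i).1| + `|(p i).2|).
  have le_S i : `|(p i).1| + `|(p i).2| <= S.
    by rewrite /S (bigD1 i) //= lerDl sumr_ge0.
  have S0 : 0 <= S by rewrite sumr_ge0.
  exists (`|T| + S); split; first by have := ler_norm T; lra.
    by rewrite addr_ge0.
  move=> i; have := le_S i; have := normr_ge0 (p i).1; have := normr_ge0 (p i).2.
  by have := normr_ge0 T; split; rewrite -ler_norml; lra.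
have zeros (a b : R) : a <= b -> (forall i, a <= (p i).1 <= b /\ a <= (p i).2 <= b) ->
  exists zs : seq R, [/\ uniq zs, forall z : R, z \in zs -> F z = 0
    & (n + (F a * F b * (-1) ^+ n < 0)%R <= size zs)%N].
  move=> ab pab.
  have [|||zs [uzs zsP szs]] := @zeros_of_disjoint_intervals R n F a b
      (fun i => [set t | C i (stereo e t)]) cF ab.
  - by move=> i; apply: stereo_cone_interval => //; exact: Ce.
  - by move=> i j z; exact: disj.
  - move=> i; have [? ? ?] := pP i; have [? ?] := pab i.
    by exists (p i).1, (p i).2.
  by exists zs; split => // z /zsP[].
have inj_stereo (zs : seq R) : uniq zs -> uniq (map (stereo e) zs).
  move=> uzs; rewrite map_inj_uniq // => t t' E.
  by apply: (stereo_inj e0 (ltr01 : 0 < 1 :> R)); rewrite scale1r.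
have ray_stereo (zs : seq R) u v r : u \in map (stereo e) zs -> v \in map (stereo e) zs ->
    0 < r -> u = r *: v -> u = v.
  by move=> /mapP[t _ ->] /mapP[t' _ ->] r0 /(stereo_inj e0 r0) ->.
have [fe0|fe0] := eqVneq (f e) 0.
  have [b [_ b0 bP]] := bounded 0.
  have [||zs [uzs zsP szs]] := zeros (- b) b => //; first by lra.
  exists (e :: map (stereo e) zs); split.
  - rewrite cons_uniq inj_stereo // andbT; apply/negP => /mapP[t _ E].
    by apply: (@stereo_neq_pole R e 1 t) => //; rewrite scale1r.
  - rewrite /= size_map -addn1 leq_add ?leq_b1 //.
    by apply: leq_trans szs; rewrite leq_addr.
  - by move=> u; rewrite inE => /predU1P[->//|/mapP[t /zsP Ft ->]].
  move=> u v r; rewrite !inE => /predU1P[->|us] /predU1P[->|vs] r0 E //.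
  - move/mapP: vs => [t _ vE]; case: (@stereo_neq_pole R e r^-1 t) => //.
      by rewrite invr_ge0 ltW.
    by rewrite -vE E scalerA mulVf ?scale1r // gt_eqF.
  - move/mapP: us => [t _ uE]; case: (@stereo_neq_pole R e r t) => //.
      by rewrite ltW.
    by rewrite -uE.
  exact: (ray_stereo zs _ _ r).
have [T T0 far] := stereo_far cf homf fe0.
have [b [Tb b0 bP]] := bounded T.
have [||zs [uzs zsP szs]] := zeros (- b) b => //; first by lra.
exists (map (stereo e) zs); split.
- exact: inj_stereo.
- rewrite size_map; apply: leq_trans szs; rewrite leq_add2l.
  case: (boolP (odd n)) => // on.
  rewrite -signr_odd on expr1 mulrN1 oppr_lt0.
  suff -> : 0 < F (- b) * F b by [].
  have := far (- b); have := far b; rewrite normrN ger0_norm // => /(_ Tb) h1 /(_ Tb) h2.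
  rewrite -(pmulr_rgt0 _ (_ : 0 < f e ^+ 2)); last by rewrite exprn_even_gt0.
  have -> : f e ^+ 2 * (F (- b) * F b) = (F (- b) * f e) * (F b * f e) by ring.
  exact: mulr_gt0.
- by move=> u /mapP[t /zsP Ft ->].
by move=> u v r; exact: ray_stereo.
Qed.

End ZeroDirections.

(** * Common supporting lines *)

Section Lines.
Context {R : realType}.
Local Notation plane := 'rV[R]_2.
Implicit Types (a b c d u v w x y z e : plane) (r s t : R) (K L A C : set plane).

Lemma line_normal_unique u v (c d : R) : u != 0 -> v != 0 ->
  [set x | dot u x = c] = [set x | dot v x = d] ->
  exists r, [/\ r != 0, v = r *: u & d = r * c].
Proof.
move=> u0 v0 E.
have N0 := dot_self_neq0 u0.
pose x0 := (c / dot u u) *: u.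
have onL t : dot v (x0 + t *: rot u) = d.
  suff : [set x | dot v x = d] (x0 + t *: rot u) by [].
  by rewrite -E /= dotDr !dotZr dot_rot mulr0 addr0 divfK.
have w0 : dot (rot u) v = 0.
  have := onL 0; have := onL 1.
  by rewrite !dotDr !dotZr (dotC v (rot u)); lra.
have vE : v = (dot u v / dot u u) *: u.
  by have := rot_basis v u0; rewrite w0 mul0r scale0r addr0.
exists (dot u v / dot u u); split => //.
  by apply: contra v0 => /eqP r0; rewrite vE r0 scale0r.
have := onL 0; rewrite scale0r addr0 => <-.
by rewrite /x0 dotZr (dotC v); field.
Qed.

(** If the lines given by the zeros [u] and [- u] of [f] coincide, then [K] and [L]
are contained in this line, and [f] depends only on the component of its argument
along the line. Hence [f] has a constant sign on each side of the axis spanned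
by [u]. Of three disjoint cones, one contains neither [u] nor [- u]; being convex
it stays on one side of the axis, so that [f] cannot take both signs on it. *)
Lemma no_antipodal_zeros n (C : 'I_n -> set plane) K L u : (3 <= n)%N ->
  compact K -> K !=set0 -> compact L -> L !=set0 ->
  let f v := support_fun K v - support_fun L v in
  (forall i, convex_cone (C i)) ->
  (forall i j v, C i v -> C j v -> i = j) ->
  (forall i, ~ C i 0) ->
  (forall i, exists v w, [/\ C i v, C i w, 0 < f v & f w < 0]) ->
  u != 0 -> f u = 0 -> f (- u) = 0 -> support_fun K (- u) <> - support_fun K u.
Proof.
move=> n3 cK K0 cL L0 f convC disj C0 signs u0 fu fNu hKN.
have homf r v : 0 < r -> f (r *: v) = r * f v.
  by move=> r0; rewrite /f !support_funZ // mulrBr.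
have hLN : support_fun L (- u) = - support_fun L u.
  by move: fu fNu; rewrite /f; lra.
have on_line M x : compact M -> M x -> support_fun M (- u) = - support_fun M u ->
    dot u x = support_fun M u.
  move=> cM Mx hN; have := support_fun_ub u cM Mx; have := support_fun_ub (- u) cM Mx.
  by rewrite dotNl hN; lra.
(* Adding a multiple of [u] translates the support function by a constant. *)
have shift M r s : compact M -> M !=set0 -> support_fun M (- u) = - support_fun M u ->
    support_fun M (r *: u + s *: rot u) =
    r * support_fun M u + support_fun M (s *: rot u).
  move=> cM M0 hN; apply/eqP; rewrite eq_le; apply/andP; split.
    have [x Mx [-> _]] := support_fun_attained (r *: u + s *: rot u) cM M0.
    have := support_fun_ub (s *: rot u) cM Mx.
    by rewrite dotDl (dotZl r) (on_line _ _ cM Mx hN); lra.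
  have [x Mx [-> _]] := support_fun_attained (s *: rot u) cM M0.
  have := support_fun_ub (r *: u + s *: rot u) cM Mx.
  by rewrite dotDl (dotZl r) (on_line _ _ cM Mx hN); lra.
have fshift r s : f (r *: u + s *: rot u) = f (s *: rot u).
  rewrite /f !shift //; have := fu; rewrite /f => /eqP; rewrite subr_eq0 => /eqP ->.
  lra.
(* Each of [u] and [- u] is in at most one cone, and there are three. *)
have [m [mu mNu]] : exists m, ~ C m u /\ ~ C m (- u).
  apply: contrapT => nm.
  have cover m : C m u \/ C m (- u).
    apply: contrapT => /not_orP[? ?]; apply: nm; by exists m.
  case: n n3 C {convC C0 signs nm} disj cover => [|[|[|n]]] // _ C disj cover.
  have [] := cover (Ordinal (isT : (0 < n.+3)%N));
  have [] := cover (Ordinal (isT : (1 < n.+3)%N));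
  have [] := cover (Ordinal (isT : (2 < n.+3)%N)) => h1 h2 h3;
  by [have := disj _ _ _ h1 h2|have := disj _ _ _ h1 h3|have := disj _ _ _ h2 h3].
have [v [w [Cv Cw fv fw]]] := signs m.
(* Coordinates along [u] and along the line. *)
pose al z := dot u z / dot u u; pose be z := dot (rot u) z / dot u u.
have decomp z : z = al z *: u + be z *: rot u by exact: rot_basis.
have fE z : f z = f (be z *: rot u) by rewrite {1}(decomp z) fshift.
have f0 : f 0 = 0.
  by have := homf 2 0 (ltr0n _ 2); rewrite scaler0; lra.
have not_on_axis z r : C m z -> z <> r *: u.
  move=> Cz zE; have [r0|r0|r0] := ltgtP r 0.
  - apply: mNu; have -> : - u = (- r)^-1 *: z.
      by rewrite zE scalerA invrN mulNr mulVf ?scaleN1r // lt_eqF.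
    by apply: convex_coneZ => //; rewrite invr_gt0 oppr_gt0.
  - apply: mu; have -> : u = r^-1 *: z.
      by rewrite zE scalerA mulVf ?scale1r // gt_eqF.
    by apply: convex_coneZ => //; rewrite invr_gt0.
  by apply: (C0 m); rewrite -[0](scale0r u) -r0 -zE.
have sgn z z' : C m z -> C m z' -> 0 < be z -> be z' < 0 -> False.
  move=> Cz Cz' bz bz'.
  apply: (@not_on_axis (be z *: z' + (- be z') *: z) (be z * al z' - be z' * al z)).
    by apply: convC => //; lra.
  move: (decomp z) (decomp z'); move: (al z) (be z) (al z') (be z').
  move=> p q p' q' -> ->.
  by apply: plane_ext; rewrite !mxE; ring.
have fpos z : 0 < be z -> f z = be z * f (rot u) by move=> bz; rewrite fE homf.
have fneg z : be z < 0 -> f z = - be z * f (- rot u).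
  by move=> bz; rewrite fE -homf ?oppr_gt0 // scalerN scaleNr opprK.
have fnz z : f z != 0 -> be z != 0.
  by apply: contra => /eqP bz; rewrite fE bz scale0r f0.
have := fnz v; have := fnz w; rewrite (gt_eqF fv) (lt_eqF fw) => /(_ isT) + /(_ isT).
have [bv|bv|//] := ltgtP (be v) 0; have [bw|bw|//] := ltgtP (be w) 0 => _ _.
- move: fv fw; rewrite (fneg v) // (fneg w) //.
  rewrite pmulr_rgt0 ?pmulr_rlt0 ?oppr_gt0 // => h1 h2.
  by have := lt_trans h1 h2; rewrite ltxx.
- exact: (sgn w v).
- exact: (sgn v w).
move: fv fw; rewrite (fpos v) // (fpos w) // pmulr_rgt0 ?pmulr_rlt0 // => h1 h2.
by have := lt_trans h1 h2; rewrite ltxx.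
Qed.

Lemma support_line_common K L u : compact K -> K !=set0 -> compact L -> L !=set0 ->
  u != 0 -> support_fun K u = support_fun L u ->
  common_supporting_line K L [set x | dot u x = support_fun K u].
Proof.
move=> cK K0 cL L0 u0 E.
have bounded : closed_halfplane_bounded_by [set x | dot u x = support_fun K u]
    [set x | dot u x <= support_fun K u] by exists u, (support_fun K u).
have line : is_line [set x | dot u x = support_fun K u] by exists u, (support_fun K u).
have KH : K `<=` [set x | dot u x <= support_fun K u].
  by move=> x Kx; exact: support_fun_ub.
have LH : L `<=` [set x | dot u x <= support_fun K u].
  by move=> x Lx; rewrite /= E; exact: support_fun_ub.
split; last by exists [set x | dot u x <= support_fun K u].
  split => //; last by exists [set x | dot u x <= support_fun K u].
  by have [x Kx [hx _]] := support_fun_attained u cK K0; exists x.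
split => //; last by exists [set x | dot u x <= support_fun K u].
by have [x Lx [hx _]] := support_fun_attained u cL L0; exists x; split; rewrite //= E.
Qed.

End Lines.

Theorem theorem1 (R : realType) (n : nat) (n_ge3 : (3 <= n)%N)
  (P : set 'rV[R]_2) (G : 'I_n -> 'rV[R]_2) (PG : convex_ngon P G)
  (A : bool -> set 'rV[R]_2)
  (Acompact : forall i, compact (A i)) (AP : forall i, A i `<=` P)
  (s : nat)
  (card_s : ([set l | common_supporting_line (A false) (A true) l] #= `I_s)%card)
  (s_lt : (s < if odd n then n.+1 else n)%N) :
  exists (i : bool) (j : 'I_n),
    A i `<=` convex_hull (A (~~ i) `|` \bigcup_(k in [set k | k != j]) [set G k]).
Proof.
apply: contrapT => no_ij.
have escape i j : exists2 p, A i p &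
    ~ convex_hull (A (~~ i) `|` \bigcup_(k in [set k | k != j]) [set G k]) p.
  apply: contrapT => nop; apply: no_ij; exists i, j => p Ap.
  by apply: contrapT => ?; apply: nop; exists p.
have j0 : 'I_n by exact: (Ordinal (leq_trans _ n_ge3 : (0 < n)%N)).
have A0 i : A i !=set0 by have [p Ap _] := escape i j0; exists p.
pose h i := support_fun (A i).
have witness i j : exists2 u, normal_cone G j u & h (~~ i) u < h i u.
  have [p Ap hullp] := escape i j.
  have [||u uP] := strict_separation _ _ hullp.
  - apply: compactU => //; apply: finite_compact.
    apply: bigcup_finite => *; last exact: finite_set1.
    exact: finite_finset.
  - by have [x Ax] := A0 (~~ i); exists x; left.
  have Gp k : k != j -> dot u (G k) < dot u p.
    by move=> kj; apply: uP; right; exists k.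
  exists u.
    suff pj : dot u p <= dot u (G j).
      by move=> k kj; apply: lt_le_trans pj; exact: Gp.
    rewrite leNgt; apply/negP => jp.
    suff : `]-oo, dot u p[%classic (dot u p) by rewrite /= in_itv /= ltxx.
    have := AP _ _ Ap; rewrite (proj1 PG); apply: convex_hull_dot_interval.
      exact: interval_is_interval.
    move=> _ [k _ <-]; rewrite /= in_itv /=.
    by have [->|/Gp] := eqVneq k j.
  apply: lt_le_trans (support_fun_ub u (Acompact i) Ap).
  rewrite /h; have [x Ax [-> _]] := support_fun_attained u (Acompact (~~ i)) (A0 (~~ i)).
  by apply: uP; left.
pose f u := h false u - h true u.
have cf : continuous f.
  have ch i : continuous (h i) := support_fun_continuous (Acompact i) (A0 i).
  by move=> u; apply: (@cvgB _ _ _ _ (nbhs_filter u)); exact: ch.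
have homf r u : 0 < r -> f (r *: u) = r * f u.
  by move=> r0; rewrite /f /h !support_funZ // mulrBr.
have signs j : exists u v, [/\ normal_cone G j u, normal_cone G j v, 0 < f u & f v < 0].
  have [u Nu hu] := witness false j; have [v Nv hv] := witness true j.
  by exists u, v; split; rewrite // /f ?subr_gt0 // subr_lt0.
have [e e0 Ne] : exists2 e, e != 0 & forall i, ~ normal_cone G i e.
  by apply: tie_direction => // j; have [u Nu _] := witness false j; exists u.
have N0 i : ~ normal_cone G i 0 by apply: normal_cone_nonzero; exact: ltnW.
have [|us [uus size_us usP ray]] := zero_directions cf homf
  (@normal_cone_convex _ _ G) (@normal_cone_disjoint _ _ G) signs e0.
  move=> i r; rewrite le_eqVlt => /predU1P[<-|r0]; first by rewrite scale0r.
  move=> Nre; apply: (Ne i); rewrite -[e]scale1r -(mulVf (lt0r_neq0 r0)) -scalerA.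
  by apply: (convex_coneZ (@normal_cone_convex _ _ G i)); rewrite // invr_gt0.
pose line u := [set x | dot u x = h false u].
(* Proportional normals: a positive ratio is excluded by the choice of [us], and a
   negative one by [no_antipodal_zeros]. *)
have line_inj u v : u \in us -> v \in us -> line u = line v -> u = v.
  move=> uin vin luv; have [u0 fu] := usP _ uin; have [v0 fv] := usP _ vin.
  have [r [r0 vE hE]] := line_normal_unique u0 v0 luv.
  have [rneg|rpos|/eqP] := ltgtP r 0; last by rewrite (negbTE r0).
    have vE' : v = (- r) *: (- u) by rewrite scalerN scaleNr opprK.
    have fNu : f (- u) = 0.
      apply/eqP; rewrite -(mulrI_eq0 _ (mulfI (_ : - r != 0))) ?oppr_eq0 //.
      by rewrite -homf ?oppr_gt0 // -vE' fv.
    case: (no_antipodal_zeros n_ge3 (Acompact false) (A0 false) (Acompact true)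
      (A0 true) (@normal_cone_convex _ _ G) (@normal_cone_disjoint _ _ G)
      N0 signs u0 fu fNu).
    apply: (mulfI (_ : - r != 0)); first by rewrite oppr_eq0.
    by rewrite -support_funZ ?oppr_gt0 // -vE' -/(h false v) hE mulrNN.
  by apply/esym; apply: (ray v u r).
have : (`I_(size us) #<= `I_s)%card.
  rewrite -(card_le_eqr card_s).
  have inj : {in `I_(size us) &, injective (fun k => line (nth 0 us k))}.
    move=> k l; rewrite !inE /= => ks ls /line_inj E; apply/eqP.
    by rewrite -(nth_uniq 0 ks ls uus); apply/eqP/E; exact: mem_nth.
  rewrite -(card_le_eql (inj_card_eq inj)); apply: subset_card_le.
  move=> _ [k ks <-]; have [u0 fu] := usP _ (mem_nth 0 ks).
  apply: support_line_common => //; apply/eqP.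
  by rewrite -subr_eq0; apply/eqP.
rewrite card_le_II leqNgt; case/negP; apply: leq_trans size_us.
by move: s_lt; case: odd; rewrite ?addn1 ?addn0.
Qed.
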